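(* Let $n\ge1$ and let $G$ be a non-solvable $\mathrm{GBS}_n$ group, written as the fundamental group of a finite graph of groups $\Gamma$ all of whose edge and vertex groups are isomorphic to $\mathbb{Z}^n$. Then $\Sigma(G)=S(G,H)^c$, with $H$ any edge or vertex group of $\Gamma$.
   Context: A $\mathrm{GBS}_n$ group (rank $n$ generalized Baumslag-Solitar group) is the fundamental group of a finite graph of groups all of whose edge and vertex groups are isomorphic to $\mathbb{Z}^n$. For a finitely generated group $G$, $S(G)$ is the sphere of classes $[\varphi]$ of nonzero homomorphisms $\varphi:G\to\mathbb{R}$, where $[\varphi]=[\psi]$ iff $\varphi=\lambda\psi$ for some real $\lambda>0$. For a finite generating set $\mathcal{G}$ of $G$, $\mathrm{Cay}(G,\mathcal{G})$ is the Cayley graph with vertex set $G$ and edges joining $g$ to $gs$ for $s\in\mathcal{G}$, and $\mathrm{Cay}(G,\mathcal{G})^{[0,\infty)}$ is its induced subgraph on $\{g:\varphi(g)\ge0\}$. The Bieri-Neumann-Strebel invariant $\Sigma(G)\subset S(G)$ is the set of $[\varphi]$ such that $\mathrm{Cay}(G,\mathcal{G})^{[0,\infty)}$ is connected for some (equivalently every) finite generating set $\mathcal{G}$. For a subgroup $H\subset G$, $S(G,H)=\{[\varphi]\in S(G):H\subset\ker\varphi\}$ and $S(G,H)^c$ is its complement in $S(G)$. *)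

(* Defs.v *)
From HB Require Import structures.
From mathcomp Require Import all_boot all_order all_algebra.
From mathcomp Require Import generic_quotient.
From mathcomp Require Import all_classical all_reals.

Set Implicit Arguments.
Unset Strict Implicit.
Unset Printing Implicit Defensive.

Import Order.TTheory GRing.Theory Num.Theory.

Local Open Scope classical_set_scope.
Local Open Scope ring_scope.

Section Groups.
Variable G : groupType.
Implicit Types (A M : set G) (s : seq G).

Definition is_subgroup M : Prop :=
  [/\ M 1%g, forall x y, M x -> M y -> M (x * y)%g & forall x, M x -> M x^-1%g].

Definition generated A : set G := smallest is_subgroup A.

Definition commutator A B : set G :=
  generated [set z | exists x y, [/\ A x, B y & z = [~ x, y]%g]].

Fixpoint derived_series k : set G :=
  if k is k'.+1 then commutator (derived_series k') (derived_series k')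
  else setT.

Definition solvable_group : Prop := exists k, derived_series k = [set 1%g].

Definition generating_seq s : Prop := generated [set` s] = setT.

End Groups.

Definition isomorphic_to_Zn (n : nat) (G : groupType) : Prop :=
  exists f : G -> 'rV[int]_n,
    {morph f : x y / (x * y)%g >-> x + y} /\ bijective f.

(* Edges are given with a chosen orientation; loops and multiple edges are
   allowed. *)
Record graph := Graph {
  vert : finType;
  edge : finType;
  src : edge -> vert;
  tgt : edge -> vert
}.

Definition adj (X : graph) (A : {set edge X}) : rel (vert X) := fun x y =>
  [exists e in A, ((src e == x) && (tgt e == y))
               || ((src e == y) && (tgt e == x))].

Definition connected_graph (X : graph) : Prop :=
  (0 < #|vert X|)%N /\ forall x y, connect (adj [set: edge X]%SET) x y.

(* A circuit through e amounts to a path joining the ends of e that avoids e,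
   so the second clause says that A contains no circuit (nor any loop). *)
Definition spanning_tree (X : graph) (A : {set edge X}) : Prop :=
  (forall x y, connect (adj A) x y) /\
  (forall e, e \in A -> ~~ connect (adj (A :\ e)%SET) (src e) (tgt e)).

Record graph_of_groups := GraphOfGroups {
  ggraph :> graph;
  ggraph_connected : connected_graph ggraph;
  vgrp : vert ggraph -> groupType;
  egrp : edge ggraph -> groupType;
  smono : forall e, {multiplicative egrp e -> vgrp (src e)};
  tmono : forall e, {multiplicative egrp e -> vgrp (tgt e)};
  smono_inj : forall e, injective (smono e);
  tmono_inj : forall e, injective (tmono e)
}.

(* The fundamental group of X relative to T: words in the elements of the
   vertex groups and the letters (e, true) = t_e, (e, false) = t_e^-1, modulo
   the relations of the vertex groups, t_e * tmono c * t_e^-1 = smono c for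
   c in the group of e, and t_e = 1 for e in T. *)
Section FundamentalGroup.
Variables (X : graph_of_groups) (T : {set edge X}).

Definition letter : Type := ({v : vert X & vgrp v} + edge X * bool)%type.
HB.instance Definition _ := Choice.on letter.
Definition word : Type := seq letter.
HB.instance Definition _ := Choice.on word.

Definition letv (v : vert X) (g : vgrp v) : letter :=
  inl (existT (fun v : vert X => vgrp v : Type) v g).
Definition lete (e : edge X) (b : bool) : letter := inr (e, b).

Inductive weq : word -> word -> Prop :=
| weq_refl w : weq w w
| weq_sym u w : weq u w -> weq w u
| weq_trans u w z : weq u w -> weq w z -> weq u z
| weq_cat u u' w w' : weq u u' -> weq w w' -> weq (u ++ w) (u' ++ w')
| weq_one v : weq [:: letv (1%g : vgrp v)] [::]
| weq_mul v (g h : vgrp v) : weq [:: letv g; letv h] [:: letv (g * h)%g]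
| weq_inv e b : weq [:: lete e b; lete e (~~ b)] [::]
| weq_edge e (c : egrp e) :
    weq [:: lete e true; letv (tmono e c); lete e false] [:: letv (smono e c)]
| weq_tree e : e \in T -> weq [:: lete e true] [::].

Definition weqb : rel word := fun u w => `[< weq u w >].

Fact weqb_refl : reflexive weqb.
Proof. by move=> w; apply/asboolP/weq_refl. Qed.

Fact weqb_sym : symmetric weqb.
Proof. by move=> u w; apply/asboolP/asboolP; exact: weq_sym. Qed.

Fact weqb_trans : transitive weqb.
Proof.
by move=> w u z /asboolP uw /asboolP wz; apply/asboolP; exact: weq_trans wz.
Qed.

Canonical weqb_equiv := EquivRel weqb weqb_refl weqb_sym weqb_trans.

Definition pi1 : Type := {eq_quot weqb}%qT.
HB.instance Definition _ := Choice.on pi1.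

Definition wclass (w : word) : pi1 := (\pi_({eq_quot weqb}) w)%qT.
Definition wrepr (x : pi1) : word := repr (x : {eq_quot weqb}%qT).

Lemma wclassK x : wclass (wrepr x) = x.
Proof. exact: reprK. Qed.

Lemma wclassP u w : wclass u = wclass w <-> weq u w.
Proof.
split=> [/eqmodP/asboolP //|uw].
by apply/eqmodP/asboolP.
Qed.

Lemma wrepr_class w : weq (wrepr (wclass w)) w.
Proof. by apply/wclassP; rewrite wclassK. Qed.

Definition linv (l : letter) : letter :=
  match l with
  | inl g => letv (tagged g)^-1%g
  | inr (e, b) => lete e (~~ b)
  end.

Definition winv (w : word) : word := rev (map linv w).

Definition pi1_one : pi1 := wclass [::].
Definition pi1_mul (x y : pi1) : pi1 := wclass (wrepr x ++ wrepr y).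
Definition pi1_inv (x : pi1) : pi1 := wclass (winv (wrepr x)).

Lemma pi1_mulE u w : pi1_mul (wclass u) (wclass w) = wclass (u ++ w).
Proof. by apply/wclassP/weq_cat; exact: wrepr_class. Qed.

Fact pi1_mulA : associative pi1_mul.
Proof.
move=> x y z; rewrite -(wclassK x) -(wclassK y) -(wclassK z).
by rewrite !pi1_mulE catA.
Qed.

Fact pi1_mul1 : left_id pi1_one pi1_mul.
Proof. by move=> x; rewrite -(wclassK x) pi1_mulE. Qed.

Fact pi1_mulr1 : right_id pi1_one pi1_mul.
Proof. by move=> x; rewrite -(wclassK x) pi1_mulE cats0. Qed.

Lemma linvr l : weq [:: l; linv l] [::].
Proof.
case: l => [[v g]|[e b]]; last exact: weq_inv.
apply: weq_trans (weq_mul _ _) _; rewrite mulgV; exact: weq_one.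
Qed.

Lemma linvl l : weq [:: linv l; l] [::].
Proof.
case: l => [[v g]|[e b]].
  apply: weq_trans (weq_mul _ _) _; rewrite mulVg; exact: weq_one.
by have := weq_inv e (~~ b); rewrite negbK.
Qed.

Lemma winvr w : weq (w ++ winv w) [::].
Proof.
elim: w => [|l w IH]; first exact: weq_refl.
rewrite /winv /= rev_cons -cats1 catA -cat1s.
apply: weq_trans (linvr l); rewrite -(cat1s l [:: linv l]) -!catA.
apply: weq_cat; first exact: weq_refl.
rewrite catA -[X in weq _ X]cat0s; apply: weq_cat => //; exact: weq_refl.
Qed.

Lemma winvl w : weq (winv w ++ w) [::].
Proof.
elim: w => [|l w IH]; first exact: weq_refl.
rewrite /winv /= rev_cons -cats1 -catA /=.
apply: weq_trans IH; apply: weq_cat; first exact: weq_refl.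
rewrite -[X in weq _ X]cat0s -[_ :: _ :: w]/([:: _; _] ++ w).
by apply: weq_cat; [exact: linvl|exact: weq_refl].
Qed.

Fact pi1_mulV : left_inverse pi1_one pi1_inv pi1_mul.
Proof.
by move=> x; rewrite -{2}(wclassK x) pi1_mulE; apply/wclassP/winvl.
Qed.

Fact pi1_mulrV : right_inverse pi1_one pi1_inv pi1_mul.
Proof.
by move=> x; rewrite -{1}(wclassK x) pi1_mulE; apply/wclassP/winvr.
Qed.

HB.instance Definition _ :=
  isGroup.Build pi1 pi1_mulA pi1_mul1 pi1_mulr1 pi1_mulV pi1_mulrV.

Definition pi1_vert (v : vert X) (g : vgrp v) : pi1 := wclass [:: letv g].

End FundamentalGroup.

Arguments pi1_vert {X} T v g.

Section LocalGroups.
Variables (X : graph_of_groups) (T : {set edge X}).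

Definition vertex_group (v : vert X) : set (pi1 T) := range (pi1_vert T v).

(* The group of e embeds in the groups of both ends of e; the two images are
   conjugate by t_e, hence equal when e is in T. *)
Definition src_edge_group (e : edge X) : set (pi1 T) :=
  pi1_vert T (src e) @` range (smono e).

Definition tgt_edge_group (e : edge X) : set (pi1 T) :=
  pi1_vert T (tgt e) @` range (tmono e).

Definition edge_or_vertex_group (K : set (pi1 T)) : Prop :=
  [\/ exists v, K = vertex_group v, exists e, K = src_edge_group e
    | exists e, K = tgt_edge_group e].

End LocalGroups.

(* All edge and vertex groups are isomorphic to Z^n. *)
Definition GBS_graph (n : nat) (X : graph_of_groups) : Prop :=
  (forall v : vert X, isomorphic_to_Zn n (vgrp v)) /\
  (forall e : edge X, isomorphic_to_Zn n (egrp e)).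

Section Sigma.
Variables (R : realType) (G : groupType).
Implicit Types (phi : G -> R) (s : seq G) (H : set G).

Definition nonzero_character phi : Prop :=
  {morph phi : x y / (x * y)%g >-> x + y} /\ exists g, phi g != 0.

Definition ray phi : set (G -> R) :=
  [set psi | exists2 lambda, 0 < lambda & phi = (fun g => lambda * psi g)].

Definition sphere : set (set (G -> R)) := [set ray phi | phi in nonzero_character].

Definition cay_edge s (g h : G) : bool :=
  has (fun x => (h == g * x)%g || (g == h * x)%g) s.

Definition cay_nonneg_edge s phi (g h : G) : bool :=
  [&& 0 <= phi g, 0 <= phi h & cay_edge s g h].

Definition cay_nonneg_connected s phi : Prop :=
  forall g h, 0 <= phi g -> 0 <= phi h ->
    exists p, path (cay_nonneg_edge s phi) g p /\ last g p = h.

Definition Sigma : set (set (G -> R)) :=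
  [set ray phi | phi in [set phi | nonzero_character phi /\
     exists s, generating_seq s /\ cay_nonneg_connected s phi]].

Definition sphere_rel H : set (set (G -> R)) :=
  [set ray phi | phi in [set phi | nonzero_character phi /\
     forall h, H h -> phi h = 0]].

End Sigma.

Arguments sphere R G : clear implicits.
Arguments Sigma R G : clear implicits.
Arguments sphere_rel R {G} H.

(* Main.v *)
(* A character phi vanishes on one vertex or edge group iff it vanishes on all of
   them, because edge groups have finite index in vertex groups.

   If phi is nonzero on the edge groups, then inside each coset of a vertex group
   one can climb arbitrarily high, and adjacent cosets can be joined at a large
   height along the elements of an edge group; so the nonnegative part of the
   Cayley graph is connected.

   If phi vanishes on the vertex groups, it is a height function on the
   Bass-Serre tree.  When the nonnegative part of the Cayley graph is connected,
   all sufficiently high points lie on the same side of any given edge of the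
   tree.  So exactly one edge at each vertex points upwards, i.e. G fixes an end
   of the tree.  Each commutator fixes a ray to that end pointwise, hence any two
   elements of G' lie in a common conjugate of a vertex group, which is abelian.

   No normal form is needed for the tree.  For an edge e, a Fox derivative
   reduced mod 2 gives a function on cosets of vertex groups that changes its
   value exactly across e, and this is all that is used about separation by e. *)
Require Import Defs.
From HB Require Import structures.
From mathcomp Require Import all_boot all_order all_algebra.
From mathcomp Require Import all_classical all_reals.

Set Implicit Arguments.
Unset Strict Implicit.
Unset Printing Implicit Defensive.

Import Order.TTheory GRing.Theory Num.Theory.

Local Open Scope classical_set_scope.
Local Open Scope ring_scope.

(** * Generated subgroups and a criterion for solvability *)

Lemma generated_subgroup (G : groupType) (A : set G) : is_subgroup (generated A).
Proof.
split; first by move=> M [[M1 _ _] _].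
  move=> x y Ax Ay M AM; have [[_ MM _] _] := AM.
  by apply: MM; [exact: Ax|exact: Ay].
by move=> x Ax M AM; have [[_ _ MV] _] := AM; apply: MV; exact: Ax.
Qed.

Lemma generated1 (G : groupType) (A : set G) : generated A 1%g.
Proof. by have [] := generated_subgroup A. Qed.

Lemma generated_min (G : groupType) (A M : set G) :
  is_subgroup M -> A `<=` M -> generated A `<=` M.
Proof. by move=> sM AM; exact: smallest_sub. Qed.

(** The derived group lies in the abelian subgroup [M], so the second derived group is trivial. *)
Lemma metabelian_solvable (G : groupType) (M : set G) : is_subgroup M ->
  (forall x y : G, M [~ x, y]%g) ->
  (forall x y : G, M x -> M y -> commute x y) -> solvable_group G.
Proof.
move=> sM Mcomm Mab; exists 2%N; apply/seteqP; split; last first.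
  by move=> _ ->; exact: generated1.
have D1M : derived_series (G := G) 1 `<=` M.
  by apply: generated_min => // _ [x [y [_ _ ->]]].
apply: generated_min => [|_ [x [y [/D1M Mx /D1M My ->]]]].
  by split=> //= [x y -> ->|x ->]; rewrite ?mulg1 ?invg1.
by apply/eqP/commgP/Mab.
Qed.

(** * Integer lattices *)

Section IntVectors.
Variable n : nat.
Implicit Types (x : 'rV[int]_n) (l : seq 'rV[int]_n).

Definition unit_vector x : Prop :=
  exists i, x = delta_mx 0 i \/ x = - delta_mx 0 i.

Lemma sum_unit_vectors x :
  exists2 l, (forall y, y \in l -> unit_vector y) & x = \sum_(y <- l) y.
Proof.
pose span x :=
  exists2 l, (forall y, y \in l -> unit_vector y) & x = \sum_(y <- l) y.
have span0 : span 0 by exists [::]; rewrite ?big_nil.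
have spanD u w : span u -> span w -> span (u + w).
  move=> [k ku ->] [l lu ->]; exists (k ++ l); rewrite ?big_cat // => y.
  by rewrite mem_cat => /orP[/ku|/lu].
have spanMn u k : span u -> span (u *+ k).
  by move=> su; elim: k => [|k IH]; rewrite ?mulr0n // mulrS; exact: spanD.
have span1 u : unit_vector u -> span u.
  by move=> uu; exists [:: u]; rewrite ?big_seq1 // => y; rewrite inE => /eqP->.
rewrite [x]row_sum_delta; elim/big_rec: _ => // i y _; apply: spanD.
case: (x 0 i) => k.
  by rewrite -natz scaler_nat; apply/spanMn/span1; exists i; left.
rewrite NegzE scaleNr -scalerN -natz scaler_nat.
by apply/spanMn/span1; exists i; right.
Qed.

(** The image of an injective endomorphism has finite index. If [A] is its matrix, injectivity gives
    [\det A != 0], and the adjugate of [A] produces a preimage of [\det A *: x]; so [k] is the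
    absolute value of the determinant. *)
Lemma int_lattice_multiple (f : 'rV[int]_n -> 'rV[int]_n) :
  {morph f : x y / x + y} -> injective f ->
  forall x, exists k y, (0 < k)%N /\ f y = x *+ k.
Proof.
move=> fD fI x.
have f0 : f 0 = 0 by apply: (addrI (f 0)); rewrite -fD !addr0.
have fN y : f (- y) = - f y by apply: (addrI (f y)); rewrite -fD !subrr f0.
pose A : 'M[int]_n := \matrix_i f (delta_mx 0 i).
have fA y : f y = y *m A.
  have [l lu ->] := sum_unit_vectors y; rewrite mulmx_suml (big_morph f fD f0).
  apply: eq_big_seq => z /lu[i [|]->]; rewrite ?mulNmx ?fN -rowE rowK //.
have detA : \det A != 0.
  apply/negP => /det0P[y y0]; rewrite -fA -f0 => /fI yE.
  by rewrite yE eqxx in y0.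
have mA y : f (y *m \adj A) = \det A *: y.
  by rewrite fA -mulmxA mul_adj_mx mul_mx_scalar.
exists `|\det A|%N; have [d0|d0] := leP 0 (\det A).
  exists (x *m \adj A); rewrite absz_gt0 mA; split=> //.
  by rewrite -[in RHS]scaler_nat natz gez0_abs.
exists (- (x *m \adj A)); rewrite absz_gt0 fN mA; split=> //.
by rewrite -[in RHS]scaler_nat natz ltz0_abs // scaleNr.
Qed.
End IntVectors.

(** * Group morphisms and additive characters *)

Section Morphisms.
Variables (G H : groupType) (f : {multiplicative G -> H}).

Lemma gmorph1 : f 1%g = 1%g.
Proof. by apply: (mulgI (f 1%g)); rewrite -gmulfM !mulg1. Qed.

Lemma gmorphV : {morph f : x / x^-1%g >-> x^-1%g}.
Proof. by move=> x; apply/esym/mulg1_eq; rewrite -gmulfM mulgV gmorph1. Qed.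

Lemma gmorphX k : {morph f : x / (x ^+ k)%g >-> (x ^+ k)%g}.
Proof.
by elim: k => [|k IH] x; rewrite ?expg0 ?gmorph1 // !expgS gmulfM IH.
Qed.
End Morphisms.

Section Characters.
Variables (G : groupType) (V : zmodType) (phi : G -> V).
Hypothesis phiM : {morph phi : x y / (x * y)%g >-> x + y}.

Lemma char1 : phi 1%g = 0.
Proof. by apply: (addrI (phi 1%g)); rewrite -phiM mulg1 addr0. Qed.

Lemma charV g : phi g^-1%g = - phi g.
Proof. by apply: (addrI (phi g)); rewrite -phiM mulgV char1 subrr. Qed.

Lemma charX g k : phi (g ^+ k)%g = phi g *+ k.
Proof. by elim: k => [|k IH]; rewrite ?expg0 ?char1 // expgS phiM IH mulrS. Qed.
End Characters.

Lemma vert_exists (X : graph_of_groups) : exists v : vert X, v \in vert X.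
Proof. by apply/card_gt0P; case: (ggraph_connected X). Qed.

(** * Oriented edges *)

Section HalfEdges.
Variable X : graph_of_groups.

Definition half_edge : Type := (edge X * bool)%type.

Implicit Type h : half_edge.

Definition hrev h : half_edge := (h.1, ~~ h.2).
Definition hsrc h : vert X := if h.2 then src h.1 else tgt h.1.
Definition htgt h : vert X := hsrc (hrev h).

(** The return clause unfolds [hsrc h], because the vertex group that receives the edge group
    depends on the orientation. *)
Definition hmono h : {multiplicative egrp h.1 -> vgrp (hsrc h)} :=
  if h.2 as b
    return {multiplicative egrp h.1 -> vgrp (if b then src h.1 else tgt h.1)}
  then smono h.1 else tmono h.1.

Lemma hrevK : involutive hrev.
Proof. by case=> e b; rewrite /hrev /= negbK. Qed.

Lemma hmono_inj h : injective (hmono h).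
Proof. by case: h => e [] /=; [exact: smono_inj|exact: tmono_inj]. Qed.

End HalfEdges.

(** * The fundamental group through an isomorphic copy [G], and cosets of vertex groups *)

Section Evaluation.
Variables (X : graph_of_groups) (T : {set edge X}).
Hypothesis hT : spanning_tree T.
Variables (G : groupType) (iota : {multiplicative pi1 T -> G}).
Hypothesis iota_bij : bijective iota.

Local Notation half := (half_edge X).
Implicit Types (h : half) (v : vert X) (g : G) (w : word X).

Definition ev w : G := iota (wclass T w).
Definition av v (a : vgrp v) : G := ev [:: letv a].
Definition tl h : G := ev [:: lete h.1 h.2].
Definition Av v : set G := range (@av v).
Definition hC h : set G := range (fun c => av (hmono h c)).

Lemma ev_cat u w : ev (u ++ w) = (ev u * ev w)%g.
Proof. by rewrite /ev -pi1_mulE; exact: gmulfM. Qed.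

Lemma ev_nil : ev [::] = 1%g.
Proof. exact: (gmorph1 iota). Qed.

Lemma ev_eq u w : ev u = ev w <-> weq T u w.
Proof.
rewrite -wclassP; split=> [|uw]; last by rewrite /ev uw.
exact: (bij_inj iota_bij).
Qed.

Lemma ev_surj g : exists w, ev w = g.
Proof.
have [f _ fK] := iota_bij; exists (wrepr (f g)).
by rewrite /ev wclassK fK.
Qed.

Lemma avM v : {morph @av v : a b / (a * b)%g >-> (a * b)%g}.
Proof. by move=> a b; rewrite /av -ev_cat; apply/ev_eq/weq_sym/weq_mul. Qed.

HB.instance Definition _ v :=
   isMultiplicative.Build (vgrp v) G (@av v) (@avM v).

Lemma tlV h : tl (hrev h) = (tl h)^-1%g.
Proof.
apply/esym/mulg1_eq; rewrite /tl -ev_cat -ev_nil; apply/ev_eq; exact: weq_inv.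
Qed.

Lemma tl_tree h : h.1 \in T -> tl h = 1%g.
Proof.
have tE e : e \in T -> tl (e, true) = 1%g.
  by move=> eT; rewrite -ev_nil; apply/ev_eq/weq_tree.
case: h => e [] /= eT; first exact: tE.
by rewrite -[(e, false)]/(hrev (e, true)) tlV tE // invg1.
Qed.

Lemma tl_edge h (c : egrp h.1) :
  (tl h * av (hmono (hrev h) c))%g = (av (hmono h c) * tl h)%g.
Proof.
have tE e (d : egrp e) :
    (tl (e, true) * av (tmono e d))%g = (av (smono e d) * tl (e, true))%g.
  apply: (mulIg (tl (e, true))^-1%g); rewrite mulgK -tlV -mulgA -!ev_cat.
  exact/ev_eq/weq_edge.
case: h c => e [] c /=; first exact: tE.
rewrite -[(e, false)]/(hrev (e, true)) tlV.
apply: (mulgI (tl (e, true))); rewrite mulVKg mulgA.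
by apply: (mulIg (tl (e, true))); rewrite mulgVK -tE.
Qed.

Lemma hC_Av h : hC h `<=` Av (hsrc h).
Proof. by move=> _ [c _ <-]; exists (hmono h c). Qed.

Lemma Av1 v : Av v 1%g.
Proof. by exists 1%g => //; exact: (gmorph1 (@av v)). Qed.

Lemma AvM v g k : Av v g -> Av v k -> Av v (g * k)%g.
Proof. by move=> [a _ <-] [b _ <-]; exists (a * b)%g => //; rewrite avM. Qed.

Lemma AvV v g : Av v g -> Av v g^-1%g.
Proof. by move=> [a _ <-]; exists a^-1%g => //; exact: (gmorphV (@av v)). Qed.

Lemma hC1 h : hC h 1%g.
Proof.
by exists 1%g => //; rewrite (gmorph1 (hmono h)); exact: (gmorph1 (@av _)).
Qed.

Lemma hCM h g k : hC h g -> hC h k -> hC h (g * k)%g.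
Proof.
move=> [a _ <-] [b _ <-]; exists (a * b)%g => //.
by rewrite gmulfM avM.
Qed.

Lemma hCV h g : hC h g -> hC h g^-1%g.
Proof.
move=> [a _ <-]; exists a^-1%g => //.
by rewrite (gmorphV (hmono h)); exact: (gmorphV (@av _)).
Qed.

Lemma hC_conj h g : hC h g -> hC (hrev h) ((tl h)^-1 * g * tl h)%g.
Proof. by move=> [c _ <-]; exists c => //; rewrite -mulgA -tl_edge mulKg. Qed.

(* Here and below, a pair (g, v) stands for the coset g (Av v), a vertex of the
   Bass-Serre tree. *)
Lemma coset_ind (P : G -> vert X -> Prop) v :
  P 1%g v ->
  (forall g u b, P g u -> Av u b -> P (g * b)%g u) ->
  (forall g h, P g (hsrc h) -> P (g * tl h)%g (htgt h)) ->
  forall g u, P g u.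
Proof.
move=> P1 PA Pt.
(* The letters of tree edges are trivial, so moving along [T] changes the vertex but not the group
   element. *)
have tree g u u' : P g u -> P g u'.
  have [/(_ u u')/connectP[p pp ->] _] := hT.
  elim: p u pp => [|x p IH] u //= /andP[/existsP[e /andP[eT ex]] xp] Pu.
  apply: IH xp _; case/orP: ex => /andP[/eqP eu /eqP eux].
    rewrite -eu in Pu; have := Pt g (e, true) Pu.
    by rewrite tl_tree // mulg1 /htgt /hsrc /= eux.
  rewrite -eux in Pu; have := Pt g (e, false) Pu.
  by rewrite tl_tree // mulg1 /htgt /hsrc /= eu.
have words w : forall g, (forall u, P g u) -> forall u, P (g * ev w)%g u.
  elim: w => [|l w IH] g Pg u; first by rewrite ev_nil mulg1.
  rewrite -cat1s ev_cat mulgA; apply: IH => {}u.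
  case: l => [[x a]|h]; first by apply: (tree _ x); apply: PA => //; exists a.
  by apply: (tree _ (htgt h)); rewrite (surjective_pairing h); exact: Pt.
move=> g u; have [w <-] := ev_surj g; rewrite -[ev w]mul1g; apply: words.
by move=> ?; exact: tree P1.
Qed.

(** * A mod 2 function on cosets that detects the crossing of one edge *)

Section Side.
Variable e : edge X.

Definition chi g : bool := `[< hC (e, true) g >].

(** Removing [e] from [T] splits the base vertices into two classes; this marks the class of
    [tgt e]. If [e] is not in [T], all base vertices stay on one side. *)
Definition tree_side v : bool :=
  (e \in T) && connect (adj (T :\ e)%SET) v (tgt e).

(** The ends of [e] are separated in [T] without [e], as [T] has no circuit; any other edge of [T]
    survives the removal and joins two vertices of one class. *)
Lemma tree_side_step h : h.1 \in T ->
  (h.1 == e) (+) tree_side (hsrc h) (+) tree_side (htgt h) = false.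
Proof.
have sym x y : connect (adj (T :\ e)%SET) x y = connect (adj (T :\ e)%SET) y x.
  apply: sym_connect_sym => {}x {}y.
  by apply: eq_existsb => f; congr (_ && _); rewrite orbC.
have tE f : f \in T ->
    (f == e) (+) tree_side (src f) (+) tree_side (tgt f) = false.
  rewrite /tree_side; case: eqP => [-> eT|/eqP fe fT].
    by rewrite eT connect0 (negbTE (hT.2 e eT)).
  case: (e \in T) => //=.
  have st : connect (adj (T :\ e)%SET) (src f) (tgt f).
    by apply: connect1; apply/existsP; exists f; rewrite !inE fe fT !eqxx.
  by rewrite (same_connect sym st) addbb.
case: h => f [] /= fT; first exact: tE.
by rewrite /hsrc /htgt /= /hsrc /= -addbA [X in _ (+) X]addbC addbA tE.
Qed.

(* The increment of side_count from g to g l, dictated by the requirement that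
   side below be constant on cosets of vertex groups (side_Av) and change across
   no other edge than e (side_tl). *)
Definition side_step g (l : letter X) : bool :=
  match l with
  | inl p => tree_side (tag p) && (chi g (+) chi (g * av (tagged p))%g)
  | inr h => ((h.1 == e) && chi (if h.2 then g else g * tl h)%g)
     (+) (tree_side (hsrc h) && chi g)
     (+) (tree_side (htgt h) && chi (g * tl h)%g)
  end.

Fixpoint side_word g w : bool :=
  if w is l :: w' then side_step g l (+) side_word (g * ev [:: l])%g w'
  else false.

Lemma side_word_cat g u w :
  side_word g (u ++ w) = side_word g u (+) side_word (g * ev u)%g w.
Proof.
elim: u g => [|l u IH] g /=; first by rewrite ev_nil mulg1.
by rewrite IH addbA -(cat1s l u) ev_cat mulgA.
Qed.

Lemma chi_hC g k : hC (e, true) k -> chi (g * k)%g = chi g.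
Proof.
move=> Ck; apply/asboolP/asboolP => [Cgk|Cg]; last exact: hCM.
by rewrite -(mulgK k g); apply: hCM Cgk _; exact: hCV.
Qed.

(** Each defining relation has total increment 0 from every starting point, so the increment along a
    word depends only on the group element. *)
Lemma side_word_weq u w : weq T u w -> forall g, side_word g u = side_word g w.
Proof.
elim=> [{}w|{}u {}w _ IH|{}u {}w z _ IH1 _ IH2|{}u u' {}w w' uu' IH1 _ IH2|v|
  v a b|  f b|f c|f fT] g //.
- by rewrite IH1.
- by rewrite !side_word_cat IH1 IH2; move/ev_eq: uu' => ->.
- by rewrite /= (gmorph1 (@av v)) mulg1 addbb andbF.
- rewrite /= !addbF avM -[ev [:: letv a]]/(av a) mulgA.
  by case: tree_side => //=; rewrite addbA -(addbA (chi g)) addbb addbF.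
- rewrite /= addbF.
  rewrite -[ev [:: lete f b]]/(tl (f, b)) -[(f, ~~ b)]/(hrev (f, b)).
  rewrite tlV mulgK /htgt hrevK /=.
  by case: b => /=; case: (f == e); case: tree_side; case: tree_side;
    case: (chi g); case: (chi _).
- rewrite /= !addbF -[ev [:: inr (f, true)]]/(tl (f, true)).
  rewrite -[ev [:: letv _]]/(av (tmono f c)).
  rewrite -[(f, false)]/(hrev (f, true)) tlV /htgt hrevK /=.
  have E : (g * tl (f, true) * av (tmono f c) * (tl (f, true))^-1
            = g * av (smono f c))%g.
    rewrite -2!(mulgA g); congr (_ * _)%g.
    by rewrite (tl_edge (h := (f, true)) c) mulgK.
  (* For [f = e] the word crosses over from [g] and comes back to [g * av (smono f c)]; both
     elements or neither lie in the edge group, so the two crossings cancel. *)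
  rewrite E; have : f = e -> chi (g * av (smono f c))%g = chi g.
    by move=> fe; apply: chi_hC; rewrite -fe; exists c.
  case: (f =P e) => [fe /(_ fe) ->|_ _]; rewrite /hsrc /=;
  by case: (tree_side _); case: (tree_side _); do 4?case: (chi _).
- rewrite /= tl_tree // mulg1 addbF.
  have := @tree_side_step (f, true) fT.
  by case: (chi g); rewrite ?andbT ?andbF.
Qed.

Definition side_count g : bool := side_word 1%g (sval (cid (ev_surj g))).

Lemma side_countM g w : side_count (g * ev w)%g = side_count g (+) side_word g w.
Proof.
rewrite /side_count; case: cid => u /= Eu; case: cid => z /= Ez.
rewrite (@side_word_weq u (z ++ w)); last by apply/ev_eq; rewrite ev_cat Ez.
by rewrite side_word_cat Ez mul1g.
Qed.

Definition side g v : bool := side_count g (+) (tree_side v && chi g).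

Lemma side_Av g v b : Av v b -> side (g * b)%g v = side g v.
Proof.
move=> [a _ <-]; rewrite /side side_countM /= addbF.
by case: tree_side; case: (chi g); case: (chi _); case: (side_count g).
Qed.

(** The edge crossed is a translate of the base edge of [h.1], by [g] or by [g * tl h] according to
    the orientation. It is the base edge of [e] itself iff [h.1 = e] and the translating element
    lies in the edge group. *)
Lemma side_tl g h :
  side (g * tl h)%g (htgt h) =
  side g (hsrc h) (+) ((h.1 == e) && chi (if h.2 then g else g * tl h)%g).
Proof.
rewrite /side side_countM /= addbF -surjective_pairing.
by case: (tree_side _); case: (tree_side _); case: (_ && _); case: (chi _);
  case: (chi _); case: (side_count g).
Qed.
End Side.

(** * Separation properties of the Bass-Serre tree *)

(* Tells the two sides of the tree edge from (1, hsrc d) to (tl d, htgt d). *)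
Definition hside d g v : bool := side d.1 (if d.2 then g else (tl d)^-1 * g)%g v.

Lemma hside_rev d g v : hside (hrev d) g v = hside d (tl d * g)%g v.
Proof.
case: d => e [] /=; rewrite /hside /=; last by rewrite mulKg.
by rewrite -tlV /hrev.
Qed.

Lemma hside_Av d g v b : Av v b -> hside d (g * b)%g v = hside d g v.
Proof.
by move=> vb; rewrite /hside; case: ifP => _; rewrite ?mulgA side_Av.
Qed.

Lemma hside_tl d g h :
  hside d (g * tl h)%g (htgt h) <> hside d g (hsrc h) <->
  (h = d /\ hC d g) \/ (h = hrev d /\ hC d (g * tl h)%g).
Proof.
have tE e k : side e (k * tl h)%g (htgt h) <> side e k (hsrc h) <->
    (h = (e, true) /\ hC (e, true) k)
    \/ (h = (e, false) /\ hC (e, true) (k * tl h)%g).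
  rewrite side_tl; split.
    case: h => f b /=; case: eqP => [->|_] /=; last by rewrite addbF.
    case: b => /=.
      by rewrite /chi; case: asboolP; [left|rewrite addbF].
    by rewrite /chi; case: asboolP; [right|rewrite addbF].
  by case=> [[-> /asboolP Ck]|[-> /asboolP Ck]] /=; rewrite eqxx /chi Ck;
    case: side.
case: d => e [] /=; rewrite /hside /= ?mulgA tE //.
set d := (e, false); have dE : (e, true) = hrev d by [].
(* For the reversed orientation, [tE] speaks of the edge group at the other end of [d]. Conjugation
   by [tl d] brings it to this end, and the two alternatives trade places. *)
rewrite -[(e, true)]/(hrev d); split=> [[[hd Ck]|[hd Ck]]|[[hd Ck]|[hd Ck]]].
- right; split=> //; have := hC_conj Ck.
  by rewrite hrevK tlV invgK mulVKg hd tlV.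
- left; split=> //; have := hC_conj Ck.
  by rewrite hrevK tlV invgK hd -!mulgA mulgV mulg1 mulVKg.
- right; split=> //; have := hC_conj Ck.
  by rewrite hd.
- left; split=> //; have := hC_conj Ck.
  by rewrite hd tlV -mulgA mulgVK.
Qed.

Lemma hside_tl1 d : hside d (tl d) (htgt d) <> hside d 1%g (hsrc d).
Proof. by rewrite -[tl d]mul1g; apply/hside_tl; left; split=> //; exact: hC1. Qed.

Lemma hside_sep v g u :
  (u = v /\ Av v g) \/
  exists d a, [/\ hsrc d = v, Av v a & hside d (a^-1 * g)%g u <> hside d 1%g v].
Proof.
move: g u; apply: (coset_ind (v := v)).
- by left; split=> //; exact: Av1.
- move=> g u b [[uv vg] ub|[d [a [dv va ne]]] ub].
    by left; split=> //; apply: AvM => //; rewrite -uv.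
  by right; exists d, a; split=> //; rewrite mulgA hside_Av.
- move=> g h [[hv vg]|[d [a [dv va ne]]]].
    right; exists h, g; split=> //.
    by rewrite mulKg -hv; exact: hside_tl1.
  have [E|/eqP/hside_tl] :=
    eqVneq (hside d (a^-1 * g * tl h)%g (htgt h)) (hside d (a^-1 * g)%g (hsrc h)).
    by right; exists d, a; split=> //; rewrite mulgA E.
  case=> [[hd Cg]|[hd Cg]]; subst h.
    case: ne; rewrite -dv -[(a^-1 * g)%g]mul1g hside_Av //.
    exact: hC_Av.
  left; rewrite /htgt hrevK dv; split=> //.
  have -> : (g * tl (hrev d) = a * (a^-1 * g * tl (hrev d)))%g.
    by rewrite -mulgA mulVKg.
  by apply: AvM => //; rewrite -dv; exact: hC_Av.
Qed.

(** The half-trees beyond two different edges at a vertex are disjoint: a path enters or leaves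
    either of them only through that common vertex, which is on the near side of both edges. *)
Lemma hside_disj d1 d2 a g u :
  hsrc d2 = hsrc d1 -> Av (hsrc d1) a -> ~ (d1 = d2 /\ hC d1 a) ->
  hside d1 g u = hside d1 1%g (hsrc d1) \/
  hside d2 (a^-1 * g)%g u = hside d2 1%g (hsrc d1).
Proof.
move=> d21 va nda; move: g u; apply: (coset_ind (v := hsrc d1)).
- by left.
- by move=> g u b [] E ub; [left|right]; rewrite ?mulgA hside_Av.
move=> g h IH.
have near d b : hsrc d = hsrc d1 -> Av (hsrc d1) b ->
    hside d b (hsrc d) = hside d 1%g (hsrc d).
  by move=> dd vb; rewrite -[b]mul1g hside_Av // dd.
have far d : hsrc d = hsrc d1 -> forall k, h = hrev d -> hC d (k * tl h)%g ->
    hside d (k * tl h)%g (htgt h) = hside d 1%g (hsrc d1).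
  move=> dd k hd /hC_Av; rewrite hd /htgt hrevK dd => vk.
  by rewrite -dd near // dd.
have [E1|/eqP/hside_tl[[hd1 C1]|[hd1 C1]]] :=
    eqVneq (hside d1 (g * tl h)%g (htgt h)) (hside d1 g (hsrc h)); last first.
- by left; apply: far.
- have [E2|/eqP/hside_tl[[hd2 C2]|[hd2 C2]]] := eqVneq
    (hside d2 (a^-1 * g * tl h)%g (htgt h)) (hside d2 (a^-1 * g)%g (hsrc h));
    last first.
  + by right; rewrite mulgA; apply: far.
  (* One step crossing both edges would make them equal: [g] and [a^-1 * g] would both lie in the
     edge group, hence so would [a]. *)
  + case: nda; split; first by rewrite -hd1.
    move: C2; rewrite -hd2 hd1 => /hCV /(hCM C1).
    by rewrite invgM invgK mulVKg.
  right; rewrite mulgA E2 hd1 -d21 near //.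
  by apply: AvM; [exact: AvV|exact: hC_Av].
case: IH => E; first by left; rewrite E1.
have [E2|/eqP/hside_tl[[hd2 C2]|[hd2 C2]]] := eqVneq
    (hside d2 (a^-1 * g * tl h)%g (htgt h)) (hside d2 (a^-1 * g)%g (hsrc h)).
- by right; rewrite mulgA E2.
- left; rewrite E1 hd2 d21 near //.
  by rewrite -(mulVKg a g); apply: AvM => //; rewrite -d21; exact: hC_Av.
- by right; rewrite mulgA; apply: far.
Qed.

(** * The fixed end, for a character that vanishes on the vertex groups *)

Section FixedEnd.
Variables (R : realType) (phi : G -> R).
Hypothesis phiM : {morph phi : x y / (x * y)%g >-> x + y}.
Hypothesis phi_neq0 : exists g, phi g != 0.
Hypothesis phi_Av : forall v g, Av v g -> phi g = 0.
Variable s : seq G.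
Hypothesis s_conn : cay_nonneg_connected s phi.

Let phi1 := char1 phiM.
Let phiV := charV phiM.
Let phiX := charX phiM.

Lemma phi_unbounded K : exists g, K <= phi g.
Proof.
have [g0 g0N] := phi_neq0.
wlog gp : g0 g0N / 0 < phi g0 => [wl|].
  have [gn|gp|g00] := ltgtP (phi g0) 0; last by rewrite g00 eqxx in g0N.
    by apply: (wl g0^-1%g); rewrite phiV ?oppr_eq0 ?oppr_gt0.
  exact: (wl g0).
exists (g0 ^+ Num.bound `|K / phi g0|%R)%g; rewrite phiX.
rewrite -mulr_natl -ler_pdivrMr //.
exact/ltW/(le_lt_trans (ler_norm _))/archi_boundP/normr_ge0.
Qed.

Definition ultimately (P : G -> Prop) : Prop :=
  exists K, forall g, K <= phi g -> P g.

Lemma ultimatelyI P Q : ultimately P -> ultimately Q ->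
  ultimately (fun g => P g /\ Q g).
Proof.
move=> [K PK] [L QL]; exists (Num.max K L) => g; rewrite ge_max => /andP[? ?].
by split; auto.
Qed.

Lemma ultimatelyW (P Q : G -> Prop) : (forall g, P g -> Q g) ->
  ultimately P -> ultimately Q.
Proof. by move=> PQ [K PK]; exists K => g /PK/PQ. Qed.

Lemma ultimately_shift P k : ultimately P -> ultimately (fun g => P (g * k)%g).
Proof.
move=> [K PK]; exists (K - phi k) => g Kg; apply: PK.
by rewrite phiM -lerBlDr.
Qed.

Lemma ultimately_shiftl P k : ultimately P -> ultimately (fun g => P (k * g)%g).
Proof.
move=> [K PK]; exists (K - phi k) => g Kg; apply: PK.
by rewrite phiM -lerBlDl.
Qed.

Lemma ultimately_all (I : eqType) (r : seq I) (P : I -> G -> Prop) :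
  (forall i, ultimately (P i)) ->
  ultimately (fun g => forall i, i \in r -> P i g).
Proof.
move=> uP; elim: r => [|i r IH]; first by exists 0.
apply: ultimatelyW (ultimatelyI (uP i) IH) => g [Pi Pr] j.
by rewrite inE => /orP[/eqP->|/Pr].
Qed.

Lemma ultimately_ex P : ultimately P -> exists g, P g.
Proof. by move=> [K PK]; have [g /PK] := phi_unbounded K; exists g. Qed.

Lemma ultimately_notin_hC d : ultimately (fun g => chi d g = false).
Proof.
exists 1 => g g1; apply/asboolP => /hC_Av/phi_Av g0.
by move: g1; rewrite g0 ler10.
Qed.

(** Every term of the increment carries a factor [chi], which is false at large height; a fixed word
    visits only finitely many translates of its starting point. *)
Lemma side_word_ultimately e w : ultimately (fun g => side_word e g w = false).
Proof.
elim: w => [|l w IH]; first by exists 0.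
have := ultimately_notin_hC e => U0.
have U1 := ultimately_shift (ev [:: l]) U0.
apply: ultimatelyW (ultimatelyI (ultimatelyI U0 U1)
  (ultimately_shift (ev [:: l]) IH)) => g [[g0 g1] /= ->].
rewrite addbF; case: l g1 {U1} => [[v a]|h] /=.
  by rewrite g0 => ->; rewrite andbF.
rewrite {1}[h]surjective_pairing => g1.
by rewrite (fun_if (chi e)) g0 g1 if_same !andbF.
Qed.

(** Above some height [K], no generator in [s] changes [side_count]. If [g] and [k] are above [K]
    with [phi g <= phi k], a nonnegative path from 1 to [g^-1 * k], translated by [g], joins them
    above [K]. *)
Lemma side_count_lim e : exists L, ultimately (fun g => side_count e g = L).
Proof.
have [K HK] : ultimately (fun g => forall x, x \in s ->
    side_count e (g * x)%g = side_count e g).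
  apply: ultimately_all => x; have [w <-] := ev_surj x.
  apply: ultimatelyW (side_word_ultimately e w) => g E.
  by rewrite side_countM E addbF.
have paths k g p : K <= phi k -> path (cay_nonneg_edge s phi) g p ->
    side_count e (k * g)%g = side_count e (k * last g p)%g.
  move=> Kk; elim: p g => [|x p IH] g //=.
  move=> /andP[/and3P[g0 x0 /hasP[y ys gx]] /IH <-].
  have le z : 0 <= phi z -> K <= phi (k * z)%g.
    by move=> z0; rewrite phiM; apply: (le_trans Kk); rewrite lerDl.
  by case/orP: gx => /eqP ->; rewrite mulgA (HK _ _ y) // le.
have const g k : K <= phi g -> K <= phi k -> side_count e g = side_count e k.
  wlog gk : g k / phi g <= phi k => [wl|] Kg Kk.
    by have [gk|/ltW kg] := leP (phi g) (phi k); [exact: wl|exact/esym/wl].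
  have [|| p [pp lp]] := s_conn (g := 1%g) (h := (g^-1 * k)%g).
  - by rewrite phi1.
  - by rewrite phiM phiV addrC subr_ge0.
  by have := paths g _ _ Kg pp; rewrite lp mulg1 mulVKg.
have [g Kg] := phi_unbounded K.
by exists (side_count e g), K => k Kk; exact: const.
Qed.

Lemma hside_lim d : exists L, ultimately (fun g => forall u, hside d g u = L).
Proof.
have [L UL] := side_count_lim d.1; exists L.
have {}UL : ultimately (fun g => forall u, side d.1 g u = L).
  apply: ultimatelyW (ultimatelyI UL (ultimately_notin_hC d.1)) => g [gL g0] u.
  by rewrite /side g0 andbF addbF.
by rewrite /hside; case: (d.2) => //; exact: (ultimately_shiftl (tl d)^-1%g UL).
Qed.

Definition outward d : Prop :=
  ultimately (fun g => forall u, hside d g u <> hside d 1%g (hsrc d)).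

(** The two ends of [d] lie on different sides, so exactly one of them is on the limit side. *)
Lemma outward_or d : outward d \/ outward (hrev d).
Proof.
have [L UL] := hside_lim d; have [dL|/eqP dL] := eqVneq (hside d 1%g (hsrc d)) L.
  right; apply: ultimatelyW (ultimately_shiftl (tl d) UL) => g gL u.
  rewrite !hside_rev gL mulg1 -dL -[hsrc (hrev d)]/(htgt d) => /esym.
  exact: hside_tl1.
by left; apply: ultimatelyW UL => g gL u; rewrite gL => /esym.
Qed.

Lemma outward_exists v : exists d, hsrc d = v /\ outward d.
Proof.
(* One height [K] serves all half-edges at once, as they are finite in number: any single element
   above [K] already shows the limit side of each of them. *)
have [K HK] : ultimately (fun g =>
    forall d : edge X * bool, d \in enum {: edge X * bool} ->
    exists2 L, (forall u, hside d g u = L) &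
      ultimately (fun g => forall u, hside d g u = L)).
  apply: ultimately_all => d; have [L UL] := hside_lim d.
  by apply: ultimatelyW (UL) => g gL; exists L.
(* The bound 1 keeps [g] out of [Av v], where [phi] is 0. The element [a] found below has height 0,
   so [a^-1 * g] is still above [K]. *)
have [g Kg] := phi_unbounded (Num.max K 1).
move: Kg; rewrite ge_max => /andP[Kg g1].
have [[_ /phi_Av g0]|[d [a [dv va ne]]]] := hside_sep v g v.
  by move: g1; rewrite g0 ler10.
exists d; split=> //.
have Ka : K <= phi (a^-1 * g)%g by rewrite phiM phiV (phi_Av va) oppr0 add0r.
have [|L aL UL] := HK _ Ka d; first by rewrite mem_enum.
by apply: ultimatelyW UL => k kL u; rewrite kL -(aL v) dv.
Qed.

(** Otherwise a high element would lie beyond two different edges at one vertex, against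
    [hside_disj]. The case [d1 = d2] says that the edge group of an outward edge is the whole vertex
    group at its source. *)
Lemma outward_uniq d1 d2 a : outward d1 -> outward d2 ->
  hsrc d2 = hsrc d1 -> Av (hsrc d1) a -> d1 = d2 /\ hC d1 a.
Proof.
move=> o1 o2 d21 va; apply: contrapT => nda.
have [g [g1 g2]] := ultimately_ex (ultimatelyI o1 (ultimately_shiftl a^-1%g o2)).
have [|] := hside_disj g (hsrc d1) d21 va nda; first exact: g1.
by rewrite -{2}d21; exact: g2.
Qed.

Definition out v : half := sval (cid (outward_exists v)).

Lemma hsrc_out v : hsrc (out v) = v.
Proof. by rewrite /out; case: cid => d []. Qed.

Lemma outward_out v : outward (out v).
Proof. by rewrite /out; case: cid => d []. Qed.

Lemma outE d : outward d -> out (hsrc d) = d.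
Proof.
move=> od; have /= := outward_uniq (outward_out (hsrc d)) od.
by rewrite hsrc_out => /(_ 1%g erefl (Av1 _))[].
Qed.

Lemma hC_out v g : Av v g -> hC (out v) g.
Proof.
move=> vg; have := outward_uniq (a := g) (outward_out v) (outward_out v) erefl.
by rewrite hsrc_out => /(_ vg)[].
Qed.

(** * Rays to the fixed end and the elements that fix such a ray *)

Implicit Types x y : G * vert X.

Definition coset_eq x y : Prop := x.2 = y.2 /\ Av x.2 (x.1^-1 * y.1)%g.

Definition parent x : G * vert X := (x.1 * tl (out x.2), htgt (out x.2))%g.

Definition translate g x : G * vert X := (g * x.1, x.2)%g.

Lemma coset_eq_refl x : coset_eq x x.
Proof. by split=> //; rewrite mulVg; exact: Av1. Qed.

Lemma coset_eq_sym x y : coset_eq x y -> coset_eq y x.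
Proof. by move=> [E /AvV]; rewrite invgM invgK; split; rewrite -?E. Qed.

Lemma coset_eq_trans x y z : coset_eq x y -> coset_eq y z -> coset_eq x z.
Proof.
move=> [E xy] [F yz]; split; first by rewrite E.
by rewrite -(mulVKg y.1 z.1) mulgA; apply: AvM => //; rewrite E.
Qed.

Lemma coset_eq_translate g x y : coset_eq x y ->
  coset_eq (translate g x) (translate g y).
Proof. by move=> [E xy]; split=> //=; rewrite invgM -mulgA mulKg. Qed.

(** Two representatives of a coset differ by an element of the vertex group. By [hC_out] it lies in
    the outward edge group, which the edge letter conjugates into the next vertex group. *)
Lemma coset_eq_parent x y : coset_eq x y -> coset_eq (parent x) (parent y).
Proof.
case: x y => [g u] [k v] [/= <- uv]; split=> //=.
have -> : ((g * tl (out u))^-1 * (k * tl (out u)) =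
    (tl (out u))^-1 * (g^-1 * k) * tl (out u))%g by rewrite invgM !mulgA.
by apply: hC_Av; apply: hC_conj; exact: hC_out.
Qed.

Lemma coset_eq_iter k x y : coset_eq x y ->
  coset_eq (iter k parent x) (iter k parent y).
Proof. by move=> xy; elim: k => //= k; exact: coset_eq_parent. Qed.

Lemma parent_translate g x : parent (translate g x) = translate g (parent x).
Proof. by rewrite /parent /translate /= mulgA. Qed.

Lemma iter_translate k g x :
  iter k parent (translate g x) = translate g (iter k parent x).
Proof. by elim: k => //= k ->; rewrite parent_translate. Qed.

Definition merge x y : Prop :=
  exists i j, coset_eq (iter i parent x) (iter j parent y).

Lemma merge_trans x y z : merge x y -> merge y z -> merge x z.
Proof.
move=> [i [j xy]] [k [l yz]]; exists (k + i)%N, (j + l)%N.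
rewrite !iterD; apply: coset_eq_trans (coset_eq_iter k xy) _.
by rewrite -iterD addnC iterD; exact: coset_eq_iter.
Qed.

(** Of two adjacent cosets, one is the parent of the other by [outward_or]. *)
Lemma merge_all v g u : merge (1%g, v) (g, u).
Proof.
move: g u; apply: (coset_ind (v := v)).
- by exists 0%N, 0%N; exact: coset_eq_refl.
- move=> g u b; move=> /merge_trans + ub; apply.
  by exists 0%N, 0%N; split; rewrite //= mulKg.
move=> g h /merge_trans; apply.
have [/outE oh|/outE oh] := outward_or h.
  by exists 1%N, 0%N; rewrite /= /parent /= oh; exact: coset_eq_refl.
exists 0%N, 1%N; rewrite /= /parent /= -[htgt h]/(hsrc (hrev h)) oh.
by rewrite /htgt hrevK tlV mulgK; exact: coset_eq_refl.
Qed.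

(** The number of steps is the same on both sides: by [iter_translate], [g] then fixes the [k]-th
    vertex of the ray from [(1, v)], and with it the rest of the ray. *)
Definition level v g : Prop :=
  exists k, coset_eq (iter k parent (g, v)) (iter k parent (1%g, v)).

Lemma level_subgroup v : is_subgroup (level v).
Proof.
have trE g k : (g * k, v)%g = translate g (k, v) by [].
split.
- by exists 0%N; exact: coset_eq_refl.
- move=> x y [i xi] [j yj]; exists (i + j)%N.
  rewrite trE iterD iter_translate iter_translate.
  apply: coset_eq_trans (coset_eq_translate x (coset_eq_iter i yj)) _.
  rewrite -iterD addnC iterD -!iter_translate -trE mulg1.
  exact: coset_eq_iter.
- move=> x [i xi]; exists i; apply: coset_eq_sym.
  have := coset_eq_translate x^-1%g xi.
  by rewrite -!iter_translate -!trE mulVg mulg1.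
Qed.

(** Step counts add up under multiplication, so the rays from [x * y] and [y * x] meet the ray from
    1 at the same vertex after equally many steps. Translation by [(y * x)^-1] turns this into a
    statement on the commutator. *)
Lemma level_commg v (x y : G) : level v [~ x, y]%g.
Proof.
have trE g k : (g * k, v)%g = translate g (k, v) by [].
have [b [a xa]] := merge_all v x v.
have [d [c yc]] := merge_all v y v.
have half z t i j k l :
    coset_eq (iter i parent (1%g, v)) (iter j parent (z, v)) ->
    coset_eq (iter k parent (1%g, v)) (iter l parent (t, v)) ->
    coset_eq (iter (i + k) parent (1%g, v)) (iter (j + l) parent (z * t, v)%g).
  move=> zi tk; rewrite addnC iterD.
  apply: coset_eq_trans (coset_eq_iter k zi) _.
  rewrite -iterD addnC !iterD trE iter_translate; apply: coset_eq_iter.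
  by rewrite -{1}(mulg1 z) trE iter_translate; exact: coset_eq_translate.
exists (a + c)%N; have xy := half _ _ _ _ _ _ xa yc.
have yx := half _ _ _ _ _ _ yc xa; rewrite addnC (addnC c) in yx.
have := coset_eq_translate (y * x)^-1%g
  (coset_eq_trans (coset_eq_sym xy) yx).
rewrite -!iter_translate -!trE mulVg invgM commgEl conjgE.
by rewrite !mulgA.
Qed.

(** Far enough along the ray from [(1, v)] there is a vertex [z] fixed by both elements; conjugation
    by [z.1] puts them into a single vertex group. *)
Lemma level_commute v (x y : G) :
  (forall (u : vert X) (a b : vgrp u), commute a b) ->
  level v x -> level v y -> commute x y.
Proof.
move=> ab [i xi] [j yj].
set z := iter (i + j) parent (1%g, v).
have fix_z g : coset_eq (translate g z) z -> Av z.2 (z.1^-1 * g * z.1)%g.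
  by move=> [_ /AvV]; rewrite /= !invgM !invgK !mulgA.
have [] : Av z.2 (z.1^-1 * x * z.1)%g /\ Av z.2 (z.1^-1 * y * z.1)%g.
  split; apply: fix_z; rewrite /z -iter_translate /translate /= mulg1.
    by rewrite addnC !iterD; exact: coset_eq_iter.
  by rewrite !iterD; exact: coset_eq_iter.
move=> [a _ aE] [b _ bE]; have := congr1 (@av _) (ab _ a b).
by rewrite !avM aE bE !mulgA => /mulIg; rewrite !mulgK -!mulgA => /mulgI.
Qed.

End FixedEnd.

(** * Connectedness, for a character that is positive somewhere on each edge group *)

Section NonnegConnected.
Variables (R : realType) (phi : G -> R) (n : nat).
Hypothesis phiM : {morph phi : x y / (x * y)%g >-> x + y}.
Variable rho : forall v, 'rV[int]_n -> vgrp v.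
Hypothesis rhoD : forall v, {morph @rho v : x y / x + y >-> (x * y)%g}.
Hypothesis rho_surj : forall v (a : vgrp v), exists x, rho v x = a.
Hypothesis phi_edge : forall h, exists2 c, hC h c & 0 < phi c.

Definition gens : seq G :=
  [seq av (rho p.1 (delta_mx 0 p.2)) | p <- enum {: vert X * 'I_n}]
  ++ [seq tl (e, true) | e <- enum (edge X)].

Let frho v x : G := av (rho v x).

Let frhoD v x y : frho v (x + y) = (frho v x * frho v y)%g.
Proof. by rewrite /frho rhoD avM. Qed.

Let frho0 v : frho v 0 = 1%g.
Proof. by apply: (mulgI (frho v 0)); rewrite -frhoD addr0 mulg1. Qed.

Let frhoN v x : frho v (- x) = (frho v x)^-1%g.
Proof. by apply: (mulgI (frho v x)); rewrite -frhoD subrr mulgV frho0. Qed.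

Lemma frho_gens v i : frho v (delta_mx 0 i) \in gens.
Proof.
by rewrite mem_cat; apply/orP; left; apply/mapP; exists (v, i); rewrite ?mem_enum.
Qed.

Lemma tl_gens e : tl (e, true) \in gens.
Proof.
by rewrite mem_cat; apply/orP; right; apply/mapP; exists e; rewrite ?mem_enum.
Qed.

Let frho_sum v l x :
  (forall y, y \in l -> unit_vector y) -> x = \sum_(y <- l) y ->
  forall M, is_subgroup M -> [set` gens] `<=` M -> M (frho v x).
Proof.
move=> + ->; elim: l => [|y l IH] gl M sM genM; have [M1 MM MV] := sM.
  by rewrite big_nil frho0.
rewrite big_cons frhoD; apply: (MM); last first.
  by apply: IH => // z zl; apply: gl; rewrite inE zl orbT.
have [|i [->|->]] := gl y; first by rewrite inE eqxx.
  exact/genM/frho_gens.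
by rewrite frhoN; exact/MV/genM/frho_gens.
Qed.

Lemma gens_generating : generating_seq gens.
Proof.
apply/seteqP; split=> // g _.
have [v _] := vert_exists X.
have sM := generated_subgroup [set` gens]; have [M1 MM MV] := sM.
have genM : [set` gens] `<=` generated [set` gens] by exact: sub_smallest.
(* The vertex [u] is a dummy that gives the claim the shape required by [coset_ind]. *)
suff gen k (u : vert X) : generated [set` gens] k by exact: (gen g v).
clear g; move: k u; apply: (coset_ind (v := v)) => // [g u b Mg [a _ <-]|g h Mg].
  apply: (MM) => //; have [x <-] := rho_surj a.
  have [l lu xl] := sum_unit_vectors x; exact: frho_sum lu xl _ sM genM.
apply: (MM) => //; case: h => e [] /=; first by apply: genM; exact: tl_gens.
rewrite -[(e, false)]/(hrev (e, true)) tlV.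
by apply: (MV); apply: genM; exact: tl_gens.
Qed.

Let linked g k := exists p, path (cay_nonneg_edge gens phi) g p /\ last g p = k.

Let linked_trans g k z : linked g k -> linked k z -> linked g z.
Proof.
by move=> [p [pp <-]] [q [pq <-]]; exists (p ++ q); rewrite cat_path last_cat pp.
Qed.

Let linked_step g k : 0 <= phi g -> 0 <= phi (g * k)%g ->
  k \in gens \/ k^-1%g \in gens -> linked g (g * k)%g.
Proof.
move=> g0 gk0 kg; exists [:: (g * k)%g]; split=> //=.
rewrite andbT /cay_nonneg_edge g0 gk0; apply/hasP.
by case: kg => kg; [exists k|exists k^-1%g] => //; rewrite ?mulgK eqxx ?orbT.
Qed.

Let linked_tl g h : 0 <= phi g -> 0 <= phi (g * tl h)%g -> linked g (g * tl h)%g.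
Proof.
move=> g0 gh0; apply: linked_step => //; case: h {gh0} => e [].
  by left; exact: tl_gens.
by right; rewrite -tlV; exact: tl_gens.
Qed.

(* Nonnegative letters go first; once only negative ones are left, every
   intermediate height is at least the final one. *)
Let linked_sum v l : forall g,
  (forall y, y \in l -> unit_vector y) -> 0 <= phi g ->
  0 <= phi (g * frho v (\sum_(y <- l) y))%g ->
  linked g (g * frho v (\sum_(y <- l) y))%g.
Proof.
have step g x : unit_vector x -> 0 <= phi g -> 0 <= phi (g * frho v x)%g ->
    linked g (g * frho v x)%g.
  move=> [i xi] g0 gx0; apply: linked_step => //.
  by case: xi => ->; [left|right; rewrite frhoN invgK]; exact: frho_gens.
have [m] := ubnP (size l); elim: m l => // m IH [|x0 l0] /=.
  by move=> _ g _ _ _; rewrite big_nil frho0 mulg1; exists [::].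
rewrite ltnS => lm g; set l := x0 :: l0 => lu g0.
have first x : x \in l -> 0 <= phi (g * frho v x)%g ->
    0 <= phi (g * frho v (\sum_(y <- l) y))%g ->
    linked g (g * frho v (\sum_(y <- l) y))%g.
  move=> xl gx0; rewrite (big_rem x) // frhoD mulgA => gl0.
  apply: linked_trans (step g x (lu x xl) g0 gx0) _.
  apply: IH => //; first by rewrite size_rem.
  by move=> y /mem_rem/lu.
have [/hasP[x xl xn]|/hasPn neg] := boolP (has (fun x => 0 <= phi (frho v x)) l).
  by apply: (first x) => //; rewrite phiM addr_ge0.
move=> gl0; apply: (first x0) => //; first by rewrite inE eqxx.
apply: le_trans gl0 _; rewrite !phiM lerD2l big_cons frhoD phiM gerDl.
have : forall y, y \in l0 -> ~~ (0 <= phi (frho v y)).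
  by move=> y yl; apply: neg; rewrite inE yl orbT.
elim: l0 {lm l lu first neg} => [|y l0 IHl] ng.
  by rewrite big_nil frho0 -(lerD2l (phi 1%g)) -phiM mulg1 addr0.
rewrite big_cons frhoD phiM -[leRHS]addr0; apply: lerD.
  by apply: ltW; rewrite ltNge ng // inE eqxx.
by apply: IHl => z zl; apply: ng; rewrite inE zl orbT.
Qed.

Let linked_Av v g b : Av v b -> 0 <= phi g -> 0 <= phi (g * b)%g ->
  linked g (g * b)%g.
Proof.
move=> [a _ <-]; have [x <-] := rho_surj a.
have [l lu ->] := sum_unit_vectors x; exact: linked_sum.
Qed.

(* To cross the edge h from g A to g t_h A', first climb along a positive
   element of its edge group, which t_h conjugates into A'. *)
Lemma gens_nonneg_connected : cay_nonneg_connected gens phi.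
Proof.
have phi1 := char1 phiM.
have linked_sym g k : linked g k -> linked k g.
  move=> [p [pp <-]]; exists (rev (belast g p)); split; last first.
    by case: p {pp} => //= x p; rewrite rev_cons last_rcons.
  rewrite rev_path; apply: sub_path pp => x y /and3P[x0 y0 /hasP[z zs xy]].
  by rewrite /cay_nonneg_edge x0 y0; apply/hasP; exists z; rewrite // orbC.
suff from1 g : 0 <= phi g -> linked 1%g g.
  move=> g k g0 k0.
  exact: linked_trans (linked_sym _ _ (from1 g g0)) (from1 k k0).
have [v _] := vert_exists X.
(* The induction is about all nonnegative elements of a coset, since the representative [g] itself
   may have negative height. *)
suff reach u : forall b, Av u b -> 0 <= phi (g * b)%g -> linked 1%g (g * b)%g.
  by move=> g0; rewrite -[g]mulg1; apply: (reach v); [exact: Av1|rewrite mulg1].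
move: g u; apply: (coset_ind (v := v)).
- move=> b vb b0; apply: linked_Av vb _ b0; by rewrite phi1.
- by move=> g u b IH ub k uk; rewrite -mulgA; apply: IH; exact: AvM.
move=> g h IH b hb gb0; have [c hc c0] := phi_edge h.
(* The power [k] of [c] is high enough to make both [g * k] and [g * k * tl h] nonnegative. *)
pose B := Num.max (- phi g) (- phi (g * tl h)%g).
pose m := Num.bound `|B / phi c|%R; pose k := (c ^+ m)%g.
have Bk : B <= phi k.
  rewrite /k (charX phiM) -mulr_natl -ler_pdivrMr //.
  exact/ltW/(le_lt_trans (ler_norm _))/archi_boundP/normr_ge0.
have hk : hC h k.
  rewrite /k; elim: (m) => [|i IHi]; rewrite ?expg0 ?expgS; first exact: hC1.
  exact: hCM.
move: Bk; rewrite ge_max => /andP[k0 kt0].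
have gk0 : 0 <= phi (g * k)%g by rewrite phiM -lerBlDl sub0r.
have gkt0 : 0 <= phi (g * k * tl h)%g.
  by rewrite !phiM addrAC -phiM -lerBlDl sub0r.
apply: linked_trans (IH k (hC_Av hk) gk0) _.
apply: linked_trans (linked_tl gk0 gkt0) _.
have -> : (g * tl h * b = g * k * tl h * ((tl h)^-1 * k * tl h)^-1 * b)%g.
  by rewrite !invgM invgK !mulgA mulgK mulgK.
rewrite -(mulgA _ _ b); apply: (linked_Av (v := htgt h)) => //.
  by apply: AvM hb; apply: AvV; exact/hC_Av/hC_conj.
by rewrite mulgA !invgM invgK !mulgA mulgK mulgK.
Qed.
End NonnegConnected.

(** * Vanishing on one edge or vertex group and on all of them *)

Section Vanishing.
Variables (R : realType) (phi : G -> R).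
Hypothesis phiM : {morph phi : x y / (x * y)%g >-> x + y}.
Hypothesis fin_index : forall h (a : vgrp (hsrc h)),
  exists k c, (0 < k)%N /\ hmono h c = (a ^+ k)%g.

Definition vanishes (A : set G) : Prop := forall g, A g -> phi g = 0.

(** A positive power of each element of the vertex group lies in the edge group, and the reals have
    no torsion. *)
Lemma vanishes_hC_Av h : vanishes (hC h) -> vanishes (Av (hsrc h)).
Proof.
move=> h0 _ [a _ <-]; have [k [c [k0 ca]]] := fin_index a.
have /eqP : phi (av a) *+ k = 0.
  by rewrite -(charX phiM) -gmorphX; apply: h0; exists c => //; rewrite ca.
by rewrite mulrn_eq0 => /orP[/eqP k00|/eqP //]; rewrite k00 in k0.
Qed.

Lemma vanishes_hrev h : vanishes (hC h) -> vanishes (hC (hrev h)).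
Proof.
move=> h0 g /hC_conj; rewrite hrevK => /h0; rewrite !phiM addrAC -phiM mulVg.
by rewrite (char1 phiM) add0r.
Qed.

(** Vanishing passes along each edge: down to the edge group, by conjugation to its other end, and
    up by [vanishes_hC_Av]. The induction serves only to reach every vertex. *)
Lemma vanishes_Av v : vanishes (Av v) -> forall u, vanishes (Av u).
Proof.
move=> v0 u; apply: (coset_ind (P := fun=> vanishes \o Av) v0 _ _ 1%g u) => //.
move=> _ h h0.
by apply: vanishes_hC_Av; apply: vanishes_hrev => g /hC_Av; exact: h0.
Qed.

Lemma vanishes_local_group K : edge_or_vertex_group K ->
  vanishes (iota @` K) <-> forall v, vanishes (Av v).
Proof.
have hCE h : vanishes (hC h) <-> forall v, vanishes (Av v).
  split=> [/vanishes_hC_Av|z g /hC_Av]; [exact: vanishes_Av|exact: z].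
case=> [[v ->]|[e ->]|[e ->]].
- have -> : iota @` vertex_group (T := T) v = Av v.
    by rewrite /vertex_group image_comp.
  by split=> [|z]; [exact: vanishes_Av|exact: z].
- have -> : iota @` src_edge_group (T := T) e = hC (e, true).
    by rewrite /src_edge_group !image_comp.
  exact: hCE.
- have -> : iota @` tgt_edge_group (T := T) e = hC (e, false).
    by rewrite /tgt_edge_group !image_comp.
  exact: hCE.
Qed.
End Vanishing.
End Evaluation.

(** * Finite index of the edge groups and the computation of Sigma *)

Lemma GBS_finite_index n (X : graph_of_groups) : GBS_graph n X ->
  forall (h : half_edge X) (a : vgrp (hsrc h)),
  exists k c, (0 < k)%N /\ hmono h c = (a ^+ k)%g.
Proof.
move=> [vZ eZ] h a.
have [f [fM f_bij]] := vZ (hsrc h); have [fe [feM [ge feK geK]]] := eZ h.1.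
have geD : {morph ge : x y / x + y >-> (x * y)%g}.
  by move=> x y; apply: (can_inj feK); rewrite feM !geK.
have f1 : f 1%g = 0 by apply: (addrI (f 1%g)); rewrite -fM mulg1 addr0.
(* In coordinates the inclusion of the edge group is an injective endomorphism of a lattice, as both
   ranks equal [n]. *)
pose F x := f (hmono h (ge x)).
have [||k [y [k0 yk]]] := @int_lattice_multiple n F _ _ (f a).
- by move=> x y; rewrite /F geD gmulfM fM.
- by move=> x y /(bij_inj f_bij)/hmono_inj/(can_inj geK).
exists k, (ge y); split=> //; apply: (bij_inj f_bij).
rewrite -[LHS]/(F y) yk.
by elim: (k) => [|m IH]; rewrite ?mulr0n ?expg0 ?f1 // expgS fM -IH mulrS.
Qed.

Theorem corollary3p2 (R : realType) (n : nat) (hn : (1 <= n)%N)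
    (X : graph_of_groups) (hX : GBS_graph n X)
    (T : {set edge X}) (hT : spanning_tree T)
    (G : groupType) (iota : {multiplicative pi1 T -> G})
    (iota_bij : bijective iota) (hG : ~ solvable_group G)
    (K : set (pi1 T)) (hK : edge_or_vertex_group K) :
  Sigma R G = sphere R G `\` sphere_rel R (iota @` K).
Proof.
have fin_index := GBS_finite_index hX.
have vab (v : vert X) (a b : vgrp v) : commute a b.
  have [f [fM f_bij]] := hX.1 v.
  by apply: (bij_inj f_bij); rewrite !fM addrC.
apply/seteqP; split=> [_ [phi [[phiM phi0] [s [_ s_conn]]] <-]|A].
  split; first by exists phi.
  move=> [psi [_ psiK] rE].
  (* Equality of the two rays makes [phi] a multiple of [psi], which vanishes on [K]. *)
  have phiK : vanishes phi (iota @` K).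
    have : ray psi psi.
      by exists 1; rewrite ?ltr01 //; apply/funext => g; rewrite mul1r.
    by rewrite rE => -[l _ ->] g /psiK ->; rewrite mulr0.
  have Av0 := (vanishes_local_group hT iota_bij phiM fin_index hK).1 phiK.
  have [v _] := vert_exists X.
  apply: hG; apply: (metabelian_solvable
    (level_subgroup hT iota_bij phiM phi0 Av0 s_conn v)) => x y.
    exact: level_commg.
  exact: level_commute.
move=> [[phi [phiM phi0] <-] nrel]; exists phi => //; split=> //.
(* Vanishing on a single edge group would spread to all vertex groups and so to [K]. A nonzero value
   is made positive by inverting the element if necessary. *)
have nz h : exists2 c, hC iota h c & 0 < phi c.
  have [c hc c0] : exists2 c, hC iota h c & phi c != 0.
    apply: contrapT => nc; apply: nrel; exists phi => //; split=> //.
    apply/(vanishes_local_group hT iota_bij phiM fin_index hK) => v.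
    have hz : vanishes phi (hC iota h).
      move=> c hc; apply/eqP; apply: contrapT => /negP c0.
      by apply: nc; exists c.
    exact: vanishes_Av (vanishes_hC_Av iota_bij phiM fin_index hz) v.
  have [cn|cp|c00] := ltgtP (phi c) 0; last by rewrite c00 eqxx in c0.
    exists c^-1%g; first exact: hCV.
    by rewrite (charV phiM) oppr_gt0.
  by exists c.
have rho_ex : forall v : vert X, exists rho : 'rV[int]_n -> vgrp v,
    {morph rho : x y / x + y >-> (x * y)%g} /\ forall a, exists x, rho x = a.
  move=> v; have [f [fM [g fK gK]]] := hX.1 v; exists g; split.
    by move=> x y; apply: (can_inj fK); rewrite fM !gK.
  by move=> a; exists (f a).
pose rho v := sval (cid (rho_ex v)).
have rhoD v : {morph rho v : x y / x + y >-> (x * y)%g}.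
  by case: (svalP (cid (rho_ex v))).
have rho_surj v a : exists x, rho v x = a.
  by case: (svalP (cid (rho_ex v))).
exists (gens iota rho); split; first exact: gens_generating.
exact: gens_nonneg_connected.
Qed.
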